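(* Let $r\ge1$ and let $n_1,\dots,n_r$ be non-negative integers. 1) If $n_1+\dots+n_r\ge3$, or $r=2$ and $n_1=n_2=1$, then the sequence $\{M(n_1,\dots,n_r,m)\}_{m=0}^\infty$ is strictly increasing. 2) If $n_1+\dots+n_r\ge3$, or $r=2$ and $n_1=n_2=1$, then for every $k$ with $1\le k\le r+1$ the sequence $\{V_k(n_1,\dots,n_r,m)\}_{m=0}^\infty$ is strictly increasing.
   Context: For non-negative integers $n_1,\dots,n_s$ with $n=n_1+\dots+n_s\ge1$, define $$M(n_1,\dots,n_s)=\frac1n\sum_{d\mid\gcd(n_1,\dots,n_s)}\mu(d)\frac{(n/d)!}{(n_1/d)!\cdots(n_s/d)!},$$ where $\mu$ is the Möbius function (and $\gcd$ with zero entries ignores zeros, e.g. $\gcd(a,0)=a$); this is the number of aperiodic circular words of length $n$ in which letter $x_i$ occurs exactly $n_i$ times. For $1\le k\le s$ put $t_k=n_1+\dots+n_k$ and $$V_k(n_1,\dots,n_s)=\frac{(-1)^{t_k}}{n}\sum_{d\mid\gcd(n_1,\dots,n_s)}\mu(d)(-1)^{t_k/d}\frac{(n/d)!}{(n_1/d)!\cdots(n_s/d)!}.$$ *)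

(* Defs.v *)
From mathcomp Require Import all_boot all_order all_algebra.

Set Implicit Arguments.
Unset Strict Implicit.
Unset Printing Implicit Defensive.

Import GRing.Theory.
Local Open Scope ring_scope.

Definition moebius (d : nat) : int :=
  if (0 < d)%N && all (fun p => logn p d == 1%N) (primes d)
  then (-1) ^+ size (primes d) else 0.

(* [gcdn a 0 = a], so zero entries are ignored. *)
Definition gcd_seq (s : seq nat) : nat := \big[gcdn/0%N]_(x <- s) x.

Definition multinomial_div (s : seq nat) (d : nat) : rat :=
  ((sumn s %/ d)`!)%:R / \prod_(x <- s) ((x %/ d)`!)%:R.

(* Meaningful when [0 < sumn s]; the family n_1, ..., n_s is the list [s]. *)
Definition M (s : seq nat) : rat :=
  (sumn s)%:R^-1 *
  \sum_(d <- divisors (gcd_seq s)) (moebius d)%:~R * multinomial_div s d.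

(* t_k = n_1 + ... + n_k, with k counted from 1 to [size s]. *)
Definition t (k : nat) (s : seq nat) : nat := sumn (take k s).

Definition V (k : nat) (s : seq nat) : rat :=
  (-1) ^+ t k s / (sumn s)%:R *
  \sum_(d <- divisors (gcd_seq s))
    (moebius d)%:~R * (-1) ^+ (t k s %/ d) * multinomial_div s d.

(* Main.v *)
(** Put s = n_1 + ... + n_r and N = s + m, and let Q_d be the multinomial
    coefficient of (n_1 / d, ..., n_r / d). The d-th term of N M(n, m) is
    mu(d) 'C(N / d, s / d) Q_d, and 'C(N / d, s / d) / N is
    'C(N / d - 1, s / d - 1) / s; the terms of V_k differ only by signs, with
    sign + at d = 1. From m to m + 1 the d = 1 term of s M grows by
    Q_1 'C(N - 1, s - 2). Since Q_d <= Q_1, it is enough that the numbers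
    'C(N' / d - 1, s / d - 1), over N' = N, N + 1 and 1 < d dividing s and N',
    add up to less than 'C(N - 1, s - 2). Each of them is at most
    'C(N - 1, s - 2) / (s - 1), and there are at most s - 2 of them. *)

Require Import Defs.
From mathcomp Require Import all_boot all_order all_algebra.
From mathcomp Require Import zify ring lra.

Set Implicit Arguments.
Unset Strict Implicit.
Unset Printing Implicit Defensive.

Import Order.TTheory GRing.Theory Num.Theory.
Local Open Scope ring_scope.

(** * Binomial estimates *)

(** Induction on [b] from [a.+1], where the left side is [(d * a).-1 * a] and the right side is at
    least ['C(d * a, 2)]. The double predecessor on the right covers the case [N' = N.+1], where
    [N.-1] is [N'.-2]. *)
Lemma bin_dilate_bound (d a b : nat) : (1 < d)%N -> (0 < a < b)%N ->
  ((d * a).-1 * 'C(b.-1, a.-1) <= 'C((d * b).-2, (d * a).-2))%N.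
Proof.
move=> d_gt1 /andP[a_gt0].
have da_ge2 : (2 <= d * a)%N by nia.
elim: b => // b IHb; rewrite ltnS leq_eqVlt => /orP[/eqP<-|lt_ab].
  have -> : 'C(a, a.-1) = a by rewrite -{1}(prednK a_gt0) binSn prednK.
  have le_da : (d * a <= (d * a.+1).-2)%N by nia.
  apply: leq_trans (leq_bin2l _ le_da).
  rewrite -[leqRHS]bin_sub; last lia.
  have -> : (d * a - (d * a).-2 = 2)%N by lia.
  rewrite bin2 -[X in (X <= _)%N]doubleK half_leq //.
  by rewrite -muln2 -mulnA mulnC leq_mul2r [(a * 2)%N]mulnC leq_mul2r d_gt1 !orbT.
have {}IHb := IHb lt_ab.
have [k def_k] : exists k, (d * a = k.+2)%N by exists (d * a).-2; lia.
have [n def_n] : exists n, (d * b = n.+2)%N by exists (d * b).-2; nia.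
rewrite def_k def_n /= in IHb *.
(* As [d >= 2], the upper index grows by at least 2, and a growth of exactly 2 already suffices. *)
have le_n : (n.+2 <= (d * b.+1).-2)%N by nia.
apply: leq_trans (leq_bin2l _ le_n).
apply: leq_trans (_ : k.+1 * 'C(b, a.-1) <= 'C(n.+2, k))%N => //=.
(* Passing from [b - 1] to [b] multiplies the left side by [b / (b - a + 1)],
   which is at most [d b / (d b - d a + 2)], a factor of the right side. *)
have EL : ((b - a.-1) * 'C(b, a.-1) = b * 'C(b.-1, a.-1))%N.
  by rewrite -mul_bin_down.
have ER : ((n.+2 - k) * 'C(n.+2, k) = n.+2 * 'C(n.+1, k))%N.
  by rewrite -mul_bin_down.
have le1 : ('C(n, k) <= 'C(n.+1, k))%N by apply: leq_bin2l.
have pos : (0 < d * (b - a.-1))%N by nia.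
rewrite -(leq_pmul2l pos).
have -> : (d * (b - a.-1) * (k.+1 * 'C(b, a.-1)) =
           n.+2 * (k.+1 * 'C(b.-1, a.-1)))%N.
  by rewrite -def_n mulnACA EL; lia.
apply: leq_trans (_ : n.+2 * 'C(n.+1, k) <= _)%N.
  by rewrite leq_mul2l (leq_trans IHb le1) orbT.
rewrite -ER leq_mul2r; apply/orP; right.
have : (d * (b - a) >= n.+2 - k.+2)%N by rewrite mulnBr def_k def_n.
nia.
Qed.

(** Apply the dilation bound with [s = d * a] and [N' = d * b]. The remaining case [a = b] forces
    [N = s], and both sides equal [s.-1]. *)
Lemma bin_div_bound (s N N' d : nat) :
  (s <= N)%N -> N' = N \/ N' = N.+1 -> (1 < d)%N -> (0 < s)%N ->
  (d %| s)%N -> (d %| N')%N ->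
  (s.-1 * 'C((N' %/ d).-1, (s %/ d).-1) <= 'C(N.-1, s.-2))%N.
Proof.
move=> le_sN defN' d_gt1 s_gt0 /dvdnP[a def_s] /dvdnP[b def_N'].
have d_gt0 : (0 < d)%N by lia.
rewrite def_N' def_s !mulnK // -def_s.
have a_gt0 : (0 < a)%N by case: a def_s => //; lia.
have le_ab : (a <= b)%N by rewrite -(leq_pmul2r d_gt0); lia.
move: le_ab; rewrite leq_eqVlt => /orP[/eqP eq_ab|lt_ab].
  rewrite -eq_ab binn muln1.
  have -> : N = s by rewrite -eq_ab -def_s in def_N'; lia.
  have [k def_k] : exists k, s = k.+2 by exists s.-2; nia.
  by rewrite def_k /= binSn.
have /= := bin_dilate_bound d_gt1 (introT andP (conj a_gt0 lt_ab)).
rewrite [(d * a)%N]mulnC [(d * b)%N]mulnC -def_s -def_N' => /leq_trans-> //.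
apply: leq_bin2l; lia.
Qed.

(** * Counting and summing the terms with [d > 1] *)

Definition proper_divisors (g : nat) : seq nat := [seq d <- divisors g | d != 1%N].

Lemma mem_proper_divisors (g d : nat) : (0 < g)%N ->
  (d \in proper_divisors g) = (1 < d)%N && (d %| g)%N.
Proof.
move=> g_gt0; rewrite mem_filter -dvdn_divisors //.
by case: d => [|[|d]] //=; rewrite dvd0n; case: g g_gt0.
Qed.

(* [s - 1] does not divide [s], and no [d > 1] divides both [m] and [m + 1]. *)
Lemma size_proper_divisors_gcd (s g m : nat) :
  (0 < g)%N -> (g %| s)%N -> (3 <= s)%N \/ (s = 2 /\ g = 1)%N ->
  (size (proper_divisors (gcdn g m) ++ proper_divisors (gcdn g m.+1)) <= s.-2)%N.
Proof.
move=> g_gt0 dvd_gs [s_ge3|[-> ->]]; last by rewrite !gcd1n.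
have gcd_gt0 k : (0 < gcdn g k)%N by rewrite gcdn_gt0 g_gt0.
(* The list is [s, 2, ..., s - 2]: a divisor [d > 1] of [s] with quotient at least 2 satisfies
   [d + 2 <= 2 * d <= s]. *)
have -> : s.-2 = size (s :: iota 2 (s - 3)) by rewrite /= size_iota; lia.
apply: uniq_leq_size.
  rewrite cat_uniq !filter_uniq ?divisors_uniq //= andbT.
  apply/hasPn => d; rewrite !mem_proper_divisors // !dvdn_gcd.
  case/and3P=> d_gt1 _ dvd_m1; apply/negP => /and3P[_ _ dvd_m].
  by move: dvd_m1; rewrite -addn1 dvdn_addr // dvdn1; lia.
move=> d; rewrite mem_cat !mem_proper_divisors // !dvdn_gcd -andb_orr.
case/andP=> d_gt1 /orP[]/andP[/dvdn_trans/(_ dvd_gs) dvd_ds _];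
  rewrite inE mem_iota; have /dvdnP[q def_s] := dvd_ds;
  case: q def_s => [|[|q]] def_s; apply/orP; (try by left; apply/eqP; lia);
  (try by move: s_ge3; rewrite def_s); right; nia.
Qed.

Lemma sum_bin_div_lt (s g m : nat) :
  (0 < g)%N -> (g %| s)%N -> (3 <= s)%N \/ (s = 2 /\ g = 1)%N ->
  (\sum_(d <- proper_divisors (gcdn g m)) 'C(((s + m) %/ d).-1, (s %/ d).-1) +
   \sum_(d <- proper_divisors (gcdn g m.+1))
      'C(((s + m.+1) %/ d).-1, (s %/ d).-1) < 'C((s + m).-1, s.-2))%N.
Proof.
move=> g_gt0 dvd_gs hs.
have s_ge2 : (2 <= s)%N by lia.
have gcd_gt0 k : (0 < gcdn g k)%N by rewrite gcdn_gt0 g_gt0.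
have size_le := size_proper_divisors_gcd m g_gt0 dvd_gs hs.
have bound k : k = m \/ k = m.+1 ->
    (s.-1 * (\sum_(d <- proper_divisors (gcdn g k))
       'C(((s + k) %/ d).-1, (s %/ d).-1)) <=
     size (proper_divisors (gcdn g k)) * 'C((s + m).-1, s.-2))%N.
  move=> def_k; rewrite big_distrr /=.
  rewrite -sum1_size big_distrl /= big_seq [leqRHS]big_seq.
  apply: leq_sum => d; rewrite mem_proper_divisors // dvdn_gcd mul1n.
  case/and3P=> d_gt1 /dvdn_trans/(_ dvd_gs) dvd_ds dvd_dk.
  by apply: bin_div_bound => //; rewrite ?dvdn_add //; lia.
have := leq_add (bound m (or_introl erefl)) (bound m.+1 (or_intror erefl)).
rewrite -mulnDr -mulnDl -size_cat => le_sum.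
(* Strictness comes from [s.-2 < s.-1], once this common factor is nonzero. *)
have C_gt0 : (0 < 'C((s + m).-1, s.-2))%N by rewrite bin_gt0; lia.
have s1_gt0 : (0 < s.-1)%N by lia.
rewrite -(ltn_pmul2l s1_gt0) (leq_ltn_trans le_sum) //.
by rewrite ltn_pmul2r //; lia.
Qed.

(** * Multinomial coefficients *)

(** As a product of binomials, the coefficient is visibly an integer and monotone in the entries. *)
Fixpoint multinomial (l : seq nat) : nat :=
  if l is x :: l' then 'C(x + sumn l', x) * multinomial l' else 1.

Lemma multinomial_fact (l : seq nat) :
  (multinomial l * \prod_(x <- l) x`! = (sumn l)`!)%N.
Proof.
elim: l => [|x l IHl] /=; first by rewrite big_nil.
rewrite big_cons mulnACA IHl -mulnA -[RHS](bin_fact (leq_addr (sumn l) x)).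
by rewrite addKn.
Qed.

Lemma prod_fact_gt0 (l : seq nat) : (0 < \prod_(x <- l) x`!)%N.
Proof. by apply: prodn_gt0 => x; rewrite fact_gt0. Qed.

(** The recursion peels off the head while [m] sits at the end, so both sides are compared after
    multiplication by all the factorials. *)
Lemma multinomial_rcons (l : seq nat) (m : nat) :
  multinomial (rcons l m) = ('C(sumn l + m, sumn l) * multinomial l)%N.
Proof.
have := multinomial_fact (rcons l m).
rewrite -cats1 big_cat big_seq1 /= sumn_cat /= addn0.
rewrite -(bin_fact (leq_addr m (sumn l))) addKn -multinomial_fact => E.
apply/eqP; rewrite -(eqn_pmul2r (prod_fact_gt0 l)) -(eqn_pmul2r (fact_gt0 m)).
by rewrite -mulnA E; apply/eqP; ring.
Qed.

Lemma leq_bin_add (x x' y y' : nat) : (x' <= x)%N -> (y' <= y)%N ->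
  ('C(x' + y', x') <= 'C(x + y, x))%N.
Proof.
move=> le_x le_y; apply: leq_trans (_ : 'C(x + y', x) <= _)%N.
  rewrite -bin_sub ?leq_addr // addKn -[leqRHS]bin_sub ?leq_addr // addKn.
  by rewrite leq_bin2l // leq_add2r.
by rewrite leq_bin2l // leq_add2l.
Qed.

Lemma sumn_map_div_le (l : seq nat) (d : nat) :
  (sumn [seq (x %/ d)%N | x <- l] <= sumn l)%N.
Proof. by elim: l => //= x l IHl; rewrite leq_add // leq_div. Qed.

Lemma multinomial_map_div_le (l : seq nat) (d : nat) :
  (multinomial [seq (x %/ d)%N | x <- l] <= multinomial l)%N.
Proof.
elim: l => //= x l IHl; rewrite leq_mul //.
by rewrite leq_bin_add ?leq_div ?sumn_map_div_le.
Qed.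

Lemma gcd_seq_rcons (l : seq nat) (m : nat) :
  gcd_seq (rcons l m) = gcdn (gcd_seq l) m.
Proof. by rewrite /gcd_seq -cats1 big_cat big_seq1. Qed.

Lemma dvdn_gcd_seq (l : seq nat) (d : nat) :
  (d %| gcd_seq l)%N = all (dvdn d) l.
Proof.
rewrite /gcd_seq; elim: l => [|x l IHl]; first by rewrite big_nil dvdn0.
by rewrite big_cons dvdn_gcd IHl.
Qed.

Lemma sumn_map_div (l : seq nat) (d : nat) : all (dvdn d) l ->
  sumn [seq (x %/ d)%N | x <- l] = (sumn l %/ d)%N /\ (d %| sumn l)%N.
Proof.
elim: l => [|x l IHl] /=; first by rewrite div0n dvdn0.
by case/andP=> dx /IHl[-> dl]; rewrite divnDl // dvdn_add.
Qed.

Lemma dvdn_gcd_seq_sumn (l : seq nat) : (gcd_seq l %| sumn l)%N.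
Proof.
by have /sumn_map_div[] : all (dvdn (gcd_seq l)) l by rewrite -dvdn_gcd_seq.
Qed.

Lemma multinomial_divE (l : seq nat) (d : nat) : (d %| gcd_seq l)%N ->
  multinomial_div l d = (multinomial [seq (x %/ d)%N | x <- l])%:R.
Proof.
rewrite dvdn_gcd_seq => /sumn_map_div[sum_div _].
rewrite /multinomial_div -sum_div -multinomial_fact natrM big_map natr_prod.
rewrite mulfK // -natr_prod pnatr_eq0 -lt0n.
by apply: prodn_gt0 => x; rewrite fact_gt0.
Qed.

(** The absorption identity [a 'C(b, a) = b 'C(b - 1, a - 1)] trades the prefactor [1 / (s + m)] for
    [1 / s], which does not depend on [m]. *)
Lemma multinomial_div_rcons (l : seq nat) (m d : nat) :
  (0 < sumn l)%N -> (d %| gcd_seq (rcons l m))%N ->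
  (sumn l + m)%:R^-1 * multinomial_div (rcons l m) d =
  (sumn l)%:R^-1 * ('C(((sumn l + m) %/ d).-1, (sumn l %/ d).-1) *
     multinomial [seq (x %/ d)%N | x <- l])%:R.
Proof.
move=> s_gt0 d_dvd; rewrite multinomial_divE // map_rcons multinomial_rcons.
move: d_dvd; rewrite gcd_seq_rcons dvdn_gcd dvdn_gcd_seq.
case/andP=> /sumn_map_div[-> dvd_s] dvd_m; move: s_gt0 dvd_s.
set s := sumn l; set Q := multinomial _ => s_gt0 dvd_s.
have d_gt0 : (0 < d)%N by apply: dvdn_gt0 dvd_s.
have a_gt0 : (0 < s %/ d)%N by rewrite divn_gt0 // dvdn_leq.
rewrite -divnDl //.
have E : (s * 'C((s + m) %/ d, s %/ d) =
          (s + m) * 'C(((s + m) %/ d).-1, (s %/ d).-1))%N.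
  rewrite -{1}(divnK dvd_s) -{2}(divnK (dvdn_add dvd_s dvd_m)).
  rewrite mulnAC [RHS]mulnAC; congr (_ * d)%N.
  by rewrite -{1 2}(prednK a_gt0) -mul_bin_diag.
have sm_neq0 : (s + m)%:R != 0 :> rat by rewrite pnatr_eq0; lia.
have s_neq0 : s%:R != 0 :> rat by rewrite pnatr_eq0; lia.
apply: (mulfI sm_neq0); rewrite mulVKf //.
apply: (mulfI s_neq0); rewrite mulrCA mulVKf //.
by rewrite -!natrM mulnA E mulnA.
Qed.

(** * Weighted divisor sums *)

(* [M] and every [V k] are instances; the weight of [V k] depends on the list, so
   the weights at [m] and [m + 1] are allowed to differ below. *)
Definition weighted_sum (c : nat -> rat) (l : seq nat) : rat :=
  (sumn l)%:R^-1 * \sum_(d <- divisors (gcd_seq l)) c d * multinomial_div l d.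

(** The term [d = 1] is the main term; the others are bounded through [|c d| <= 1] and
    [Q_d <= Q_1]. *)
Lemma weighted_sum_rcons (c : nat -> rat) (l : seq nat) (m : nat) :
  (0 < sumn l)%N -> c 1%N = 1 -> (forall d, `|c d| <= 1) ->
  `|(sumn l)%:R * weighted_sum c (rcons l m) -
    ('C((sumn l + m).-1, (sumn l).-1) * multinomial l)%:R| <=
  (\sum_(d <- proper_divisors (gcdn (gcd_seq l) m))
     'C(((sumn l + m) %/ d).-1, (sumn l %/ d).-1) * multinomial l)%:R.
Proof.
move=> s_gt0 c1 c_le1.
have G_gt0 : (0 < gcd_seq l)%N := dvdn_gt0 s_gt0 (dvdn_gcd_seq_sumn l).
have g_gt0 : (0 < gcdn (gcd_seq l) m)%N by rewrite gcdn_gt0 G_gt0.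
have s_neq0 : (sumn l)%:R != 0 :> rat by rewrite pnatr_eq0 -lt0n.
pose e d := ('C(((sumn l + m) %/ d).-1, (sumn l %/ d).-1) *
             multinomial [seq (x %/ d)%N | x <- l])%N.
have -> : (sumn l)%:R * weighted_sum c (rcons l m) =
    \sum_(d <- divisors (gcdn (gcd_seq l) m)) c d * (e d)%:R.
  rewrite /weighted_sum gcd_seq_rcons !big_distrr big_seq [RHS]big_seq /=.
  apply: eq_bigr => d; rewrite -dvdn_divisors // => d_dvd.
  rewrite sumn_rcons [X in _ * X]mulrCA multinomial_div_rcons ?gcd_seq_rcons //.
  by rewrite mulrCA mulVKf.
rewrite (bigD1_seq 1%N) ?divisors_uniq -?dvdn_divisors ?dvd1n //= c1 mul1r.
have -> : e 1%N = ('C((sumn l + m).-1, (sumn l).-1) * multinomial l)%N.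
  by rewrite /e !divn1 (eq_map divn1) map_id.
rewrite addrAC subrr add0r -big_filter natr_sum.
apply: le_trans (ler_norm_sum _ _ _) _; apply: ler_sum => d _.
rewrite normrM normr_nat -[leRHS]mul1r ler_pM // ler_nat.
by rewrite leq_mul2l multinomial_map_div_le orbT.
Qed.

Lemma multinomial_gt0 (l : seq nat) : (0 < multinomial l)%N.
Proof. by elim: l => //= x l IHl; rewrite muln_gt0 IHl bin_gt0 leq_addr. Qed.

Lemma weighted_sum_ltS (c c' : nat -> rat) (l : seq nat) (m : nat) :
  (3 <= sumn l)%N \/ (sumn l = 2 /\ gcd_seq l = 1)%N ->
  c 1%N = 1 -> (forall d, `|c d| <= 1) ->
  c' 1%N = 1 -> (forall d, `|c' d| <= 1) ->
  weighted_sum c (rcons l m) < weighted_sum c' (rcons l m.+1).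
Proof.
move=> hs c1 c_le1 c'1 c'_le1.
have s_gt0 : (0 < sumn l)%N by lia.
have dvd_Gs := dvdn_gcd_seq_sumn l.
have G_gt0 : (0 < gcd_seq l)%N by apply: dvdn_gt0 dvd_Gs.
have := sum_bin_div_lt m G_gt0 dvd_Gs hs.
rewrite -(ltn_pmul2r (multinomial_gt0 l)) mulnDl !big_distrl /=.
rewrite -(ltr_nat rat) natrD => lt_err.
have := weighted_sum_rcons m s_gt0 c1 c_le1.
have := weighted_sum_rcons m.+1 s_gt0 c'1 c'_le1.
(* By Pascal's rule the main term grows by exactly the quantity that exceeds the two error sums
   together. *)
have pascal : ('C((sumn l + m.+1).-1, (sumn l).-1) * multinomial l =
    'C((sumn l + m).-1, (sumn l).-1) * multinomial l +
    'C((sumn l + m).-1, (sumn l).-2) * multinomial l)%N.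
  have [k ->] : exists k, sumn l = k.+2 by exists (sumn l).-2; lia.
  by rewrite addnS /= addSn /= binS mulnDl.
rewrite pascal natrD !ler_norml => /andP[lo _] /andP[_ hi].
have sR_gt0 : 0 < (sumn l)%:R :> rat by rewrite ltr0n.
rewrite -(ltr_pM2l sR_gt0); lra.
Qed.

(** * The instances [M] and [V] *)

Lemma moebius_norm_le1 (d : nat) : `|(moebius d)%:~R : rat| <= 1.
Proof.
rewrite /moebius; case: ifP => _; last by rewrite normr0.
by rewrite rmorphXn /= rmorphN1 normrX normrN1 expr1n.
Qed.

Lemma M_weighted_sum (l : seq nat) :
  M l = weighted_sum (fun d => (moebius d)%:~R) l.
Proof. by []. Qed.

(** With the outer sign moved inside, the exponent at [d = 1] is twice [t k l], so that the weight
    there is 1. *)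
Lemma V_weighted_sum (k : nat) (l : seq nat) :
  V k l = weighted_sum
    (fun d => (moebius d)%:~R * (-1) ^+ (t k l + t k l %/ d)) l.
Proof.
rewrite /V /weighted_sum [_ / _]mulrC -mulrA big_distrr /=; congr (_ * _).
by apply: eq_bigr => d _; rewrite exprD; ring.
Qed.

Theorem theorem6 (r : nat) (hr : (1 <= r)%N) (n : r.-tuple nat) :
  ((3 <= sumn n)%N \/ n = [:: 1%N; 1%N] :> seq nat ->
     {homo (fun m : nat => M (rcons n m)) : m m' / (m < m')%N >-> m < m'})
  /\
  ((3 <= sumn n)%N \/ n = [:: 1%N; 1%N] :> seq nat ->
     forall k : nat, (1 <= k <= r.+1)%N ->
     {homo (fun m : nat => V k (rcons n m)) : m m' / (m < m')%N >-> m < m'}).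
Proof.
have hyp : (3 <= sumn n)%N \/ n = [:: 1%N; 1%N] :> seq nat ->
    (3 <= sumn n)%N \/ (sumn n = 2 /\ gcd_seq n = 1)%N.
  case=> [|->]; [by left | right; split=> //].
  by rewrite /gcd_seq !big_cons big_nil.
have mu1 : (moebius 1)%:~R = 1 :> rat by [].
(* By transitivity it suffices to compare [m] with [m.+1]. *)
split=> [/hyp hs | /hyp hs k _]; apply: homo_ltn => [|m]; try exact: lt_trans.
  by rewrite !M_weighted_sum weighted_sum_ltS //; apply: moebius_norm_le1.
have w1 T : (moebius 1)%:~R * (-1) ^+ (T + T %/ 1) = 1 :> rat.
  by rewrite divn1 mu1 mul1r -signr_odd addnn odd_double.
have w_le1 T d : `|(moebius d)%:~R * (-1) ^+ (T + T %/ d) : rat| <= 1.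
  by rewrite normrM normrX normrN1 expr1n mulr1 moebius_norm_le1.
rewrite !V_weighted_sum; apply: weighted_sum_ltS => //.
Qed.
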